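(* Let $\overline{\mathcal{S}}$ be the set of strict overpartitions: partitions $\lambda=(\lambda_1>\cdots>\lambda_\ell)$ into distinct positive parts in which a part $\lambda_i$ may be overlined only if $\lambda_i\ge2$ and $\lambda_i-\lambda_{i+1}\ge2$ (with $\lambda_{\ell+1}:=0$); the empty partition is included. Then $$\sum_{\lambda\in\overline{\mathcal{S}}}a^{\overline{\#}(\lambda)}z^{\#(\lambda)}q^{|\lambda|}=\sum_{n=0}^{\infty}\frac{(-aq;q)_{n}}{(q;q)_{n}}z^nq^{\frac{n(n+1)}{2}}=(-aq;q)_\infty (-zq;q)_\infty\sum_{n\ge 0}\frac{(-aq)^n}{(q;q)_n(-zq;q)_n}.$$
   Context: $\overline{\#}(\lambda)$ is the number of overlined parts, $\#(\lambda)$ the number of parts, $|\lambda|$ the sum of the parts (ignoring overlines). $(a;q)_n=\prod_{i=0}^{n-1}(1-aq^i)$ for $n\in\mathbb{Z}_{\ge0}\cup\{\infty\}$, $|q|<1$. *)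

(* Defs.v *)
From HB Require Import structures.
From mathcomp Require Import all_boot all_order all_algebra.
From mathcomp Require Import finmap.
From mathcomp Require Import all_classical all_reals all_analysis.
From mathcomp Require Import complex.
(* Unordered sums: [totally] is the filter of all large enough finite subsets
   of the index type, and [summability.sum] the limit along it. *)
From mathcomp.analysis.showcase Require summability.

Set Implicit Arguments.
Unset Strict Implicit.
Unset Printing Implicit Defensive.

Import Order.TTheory GRing.Theory Num.Theory numFieldNormedType.Exports.
Local Open Scope ring_scope.

(* The complex field over R, packaged as a numFieldType so that it carries the
   canonical topology of a normed field, given by the modulus. *)
Definition complexField (R : realType) : numFieldType := R[i].

Section StrictOverpartitions.
Local Open Scope nat_scope.

(* A list of pairs (part, is it overlined?), in decreasing order of parts.
   Reading past the end of the list gives the convention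
   lambda_(l + 1) = 0. *)
Definition part (s : seq (nat * bool)) (i : nat) : nat :=
  (nth (0, false) s i).1.

Definition overlined (s : seq (nat * bool)) (i : nat) : bool :=
  (nth (0, false) s i).2.

Definition is_strict_overpartition (s : seq (nat * bool)) : bool :=
  [&& sorted gtn [seq p.1 | p <- s],
      all (fun m => 0 < m) [seq p.1 | p <- s] &
      [forall i : 'I_(size s),
         overlined s i ==> (2 <= part s i) && (2 <= part s i - part s i.+1)]].

Record strict_overpartition := StrictOverpartition {
  sop_seq :> seq (nat * bool);
  _ : is_strict_overpartition sop_seq }.

HB.instance Definition _ := [isSub for sop_seq].
HB.instance Definition _ := [Countable of strict_overpartition by <:].

Definition num_overlined (l : strict_overpartition) : nat :=
  count (fun p => p.2) l.

Definition num_parts (l : strict_overpartition) : nat := size l.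

Definition sum_parts (l : strict_overpartition) : nat :=
  sumn [seq p.1 | p <- sop_seq l].

End StrictOverpartitions.

Definition qpoch (K : numFieldType) (a q : K) (n : nat) : K :=
  \prod_(0 <= i < n) (1 - a * q ^+ i).

Definition qpoch_inf (K : numFieldType) (a q : K) : K := limn (qpoch a q).

(* Main.v *)
(** Removing a largest part, plain or overlined, gives for the generating function
    F_N of the strict overpartitions with parts less than N the recurrence
    F_(N+2) = (1 + z q^(N+1)) F_(N+1) + a z q^(N+1) F_N.  Hence every sequence
    with x_N = (1 + z q^(N+1)) x_(N+1) + a z q^(N+2) x_(N+2) satisfies
    x_0 = F_(N+1) x_N + a z q^(N+1) F_N x_(N+1), so x_0 = (lim F) (lim x).

    This applies to the first series at z q^N, which tends to 1, and to
    x_N = sum_n b^n / (q;q)_n (c q^(n+N);q)_oo with b = - a q and c = - z q.  The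
    latter has limit sum_n b^n / (q;q)_n = 1 / (b;q)_oo by Euler's identity, and
    x_0 is (c;q)_oo times the second series since
    (c;q)_oo = (c;q)_n (c q^n;q)_oo. *)

Require Import Defs.
From mathcomp Require Import all_boot all_order all_algebra.
From mathcomp Require Import finmap.
From mathcomp Require Import all_classical all_reals all_analysis.
From mathcomp Require Import complex.
From mathcomp Require Import ring zify.
From mathcomp.analysis.showcase Require summability.
Import Order.TTheory GRing.Theory Num.Theory numFieldNormedType.Exports.
Local Open Scope ring_scope.
Local Open Scope classical_set_scope.

(** * Bounds and absolute convergence over the complex field *)

Lemma sum_geometric_le (K : numFieldType) (r : K) n :
  0 <= r < 1 -> \sum_(0 <= k < n) r ^+ k <= (1 - r)^-1.
Proof.
move=> /andP[r0 r1].
have := geometric_seriesE 1 (negbT (lt_eqF r1)).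
move=> /(congr1 (@^~ n)); rewrite /series /=.
under eq_bigr do rewrite /= mul1r.
move=> ->; rewrite mul1r ler_piMl //; first by rewrite invr_ge0 subr_ge0 ltW.
by rewrite lerBlDr lerDl exprn_ge0.
Qed.

Lemma normr_Re_le (R : rcfType) (x : R[i]) : (`|complex.Re x|%:C <= `|x|)%C.
Proof. by rewrite normc_def lecR -sqrtr_sqr ler_wsqrtr // lerDl sqr_ge0. Qed.

Lemma normr_Im_le (R : rcfType) (x : R[i]) : (`|complex.Im x|%:C <= `|x|)%C.
Proof. by rewrite normc_def lecR -sqrtr_sqr ler_wsqrtr // lerDr sqr_ge0. Qed.

Lemma cvg_complex (R : realType) (u : nat -> complexField R) (x y : R) :
  (fun n => complex.Re (u n)) @ \oo --> x ->
  (fun n => complex.Im (u n)) @ \oo --> y ->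
  u @ \oo --> (Complex x y : complexField R).
Proof.
move=> ux uy; apply/cvgrPdist_lt => e e0.
have eE : e = ((complex.Re e)%:C)%C by rewrite RRe_real // gtr0_real.
have d0 : 0 < complex.Re e / 2.
  by rewrite divr_gt0 //; move: e0; rewrite eE ltcR.
move/cvgrPdist_lt: ux => /(_ _ d0) ux.
move/cvgrPdist_lt: uy => /(_ _ d0) uy.
near=> n.
(* The modulus is at most the sum of the absolute values of the real and imaginary parts, each
   eventually below half of [e]. *)
rewrite [X in `|X|](complexE (_ : R[i])).
apply: le_lt_trans (ler_normD _ _) _.
have ni : `|('i : R[i])%C| = 1 by rewrite normc_def /= expr0n expr1n add0r sqrtr1.
rewrite normrM ni mul1r !normc_def /= !expr0n /= !addr0 !sqrtr_sqr.
rewrite eE -rmorphD /= ltcR [complex.Re e]splitr.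
have -> : complex.Re (Complex x y - u n : R[i]) = x - complex.Re (u n).
  by case: (u n).
have -> : complex.Im (Complex x y - u n : R[i]) = y - complex.Im (u n).
  by case: (u n).
by rewrite ltrD //; near: n.
Unshelve. all: by end_near. Qed.

(** The real and imaginary parts are dominated by the modulus, so both are absolutely convergent
    real series; the completeness of [R] enters here. *)
Lemma bounded_series_cvg (R : realType) (u : nat -> complexField R)
    (B : complexField R) :
  (forall n, \sum_(0 <= k < n) `|u k| <= B) -> cvgn (series u).
Proof.
move=> uB.
have part_cvg (p : {additive R[i] -> R}) :
    (forall x : R[i], (`|p x|%:C)%C <= `|x|) -> cvgn (p \o series u).
  move=> p_le.
  have -> : p \o series u = series (p \o u).
    by apply/funext => n; rewrite /= /series /= raddf_sum.
  apply: normed_cvg; apply: nondecreasing_is_cvgn.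
    by apply: nondecreasing_series => n _ _; exact: normr_ge0.
  exists (complex.Re B) => _ [n _ <-] /=.
  have : (((\sum_(0 <= k < n) `|p (u k)|)%:C)%C : R[i]) <= B.
    rewrite rmorph_sum; apply: le_trans (uB n).
    by apply: ler_sum => k _; exact: p_le.
  by rewrite lecE => /andP[].
have Re_cvg := part_cvg (@complex.Re R) (@normr_Re_le R).
have Im_cvg := part_cvg (@complex.Im R) (@normr_Im_le R).
exact: cvgP (cvg_complex _ _ _ _ Re_cvg Im_cvg).
Qed.

(** The inequality [1 + x <= expR x] turns the product into the exponential of a geometric sum,
    bounded independently of [n]. *)
Lemma prod_geometric_bounded (R : realType) (c r : complexField R) :
  0 <= c -> 0 <= r < 1 ->
  exists2 M, 0 <= M & forall n, \prod_(0 <= i < n) (1 + c * r ^+ i) <= M.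
Proof.
move=> c0 /andP[r0 r1].
have cE : c = ((complex.Re c)%:C)%C by rewrite RRe_real // ger0_real.
have rE : r = ((complex.Re r)%:C)%C by rewrite RRe_real // ger0_real.
(* Nonnegative elements of the complex field are real, so [c] and [r] may be taken in [R], where the
   exponential is available. *)
move: c0 r0 r1; rewrite cE rE; move: (complex.Re c) (complex.Re r) => {cE rE}.
move=> {}c {}r; rewrite !ler0c -[1]/((1 : R)%:C)%C ltcR => c0 r0 r1.
exists ((expR (c / (1 - r)))%:C)%C; first by rewrite ler0c expR_ge0.
move=> n; rewrite (_ : \prod_(_ <= _ < _) _ =
  ((\prod_(0 <= i < n) (1 + c * r ^+ i))%:C)%C); last first.
  rewrite rmorph_prod; apply: eq_bigr => i _.
  by rewrite rmorphD rmorphM rmorphXn.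
rewrite lecR; apply: (@le_trans _ _ (\prod_(0 <= i < n) expR (c * r ^+ i))).
  by apply: ler_prod => i _; rewrite expR_ge1Dx addr_ge0 // mulr_ge0 ?exprn_ge0.
rewrite -expR_sum ler_expR -big_distrr /= ler_wpM2l //.
by apply: sum_geometric_le; rewrite r0.
Qed.

(** * Limits and dominated convergence *)

Section Limits.
Variable K : numFieldType.

Lemma cvgn_norm_le (u : nat -> K) (l B : K) :
  u @ \oo --> l -> (forall n, `|u n| <= B) -> `|l| <= B.
Proof.
move=> ul uB; apply/ler_addgt0Pr => e e0.
have [n _ /(_ n (leqnn n)) ln] := (iffLR (cvgrPdist_lt _ _) ul) e e0.
rewrite -[l](subrK (u n)) addrC (le_trans (ler_normD _ _)) // lerD //.
exact: ltW.
Qed.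

Lemma cvgn_squeeze (u v : nat -> K) (l : K) :
  v @ \oo --> 0 -> (forall n, `|l - u n| <= v n) -> u @ \oo --> l.
Proof.
move=> v0 uv; apply/cvgrPdist_lt => e e0.
move/cvgrPdist_lt: v0 => /(_ e e0) v0; near=> n.
have : `|0 - v n| < e by near: n.
rewrite sub0r normrN => vn; apply: le_lt_trans vn; apply: le_trans (uv n) _.
(* The order is partial: [v n] is at most its norm because, dominating a norm, it is nonnegative and
   hence real. *)
exact: real_ler_norm (ger0_real (le_trans (normr_ge0 _) (uv n))).
Unshelve. all: by end_near. Qed.

(** The distance between the two sums is at most [e N * B], because [e N] bounds the error in the
    factor uniformly in [n]. *)
Lemma dominated_series_cvg (c : nat -> K) (B : K) (t : nat -> nat -> K)
    (s : nat -> K) (e : nat -> K) :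
  (forall n, \sum_(0 <= k < n) `|c k| <= B) ->
  (forall N n, `|s n - t N n| <= e N) -> e @ \oo --> 0 ->
  (forall N, cvgn (series (fun n => c n * t N n))) ->
  cvgn (series (fun n => c n * s n)) ->
  (fun N => limn (series (fun n => c n * t N n))) @ \oo -->
    limn (series (fun n => c n * s n)).
Proof.
move=> cB ste e0 ct cs; apply: (@cvgn_squeeze _ (fun N => e N * B)).
  have := cvgM e0 (cvg_cst B); rewrite mul0r; exact.
move=> N; apply: cvgn_norm_le (cvgB cs (ct N)) _ => n /=.
rewrite -[X in `|X|]/(\sum_(0 <= k < n) c k * s k -
  \sum_(0 <= k < n) c k * t N k) -sumrB (le_trans (ler_norm_sum _ _ _)) //.
have eN := le_trans (normr_ge0 _) (ste N 0%N).
apply: le_trans (ler_wpM2l eN (cB n)).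
rewrite big_distrr /=; apply: ler_sum => k _.
by rewrite -mulrBr normrM mulrC ler_wpM2r.
Qed.

End Limits.

(* [complexField R] carries no complete structure; absolutely convergent series
   are all that is needed of completeness. *)
Section Completeness.
Variable K : numFieldType.
Hypothesis summable_cvg : forall (u : nat -> K) (B : K),
  (forall n, \sum_(0 <= k < n) `|u k| <= B) -> cvgn (series u).

Lemma cvgn_expr (x : K) : `|x| < 1 -> (fun n => x ^+ n) @ \oo --> (0 : K).
Proof.
move=> x1; apply: cvg_series_cvg_0.
apply: (@summable_cvg _ (1 - `|x|)^-1) => n.
under eq_bigr do rewrite normrX.
by apply: sum_geometric_le; rewrite normr_ge0.
Qed.

(** The increments of [u] form a series whose absolute sums telescope below [B - v 0]. With [u = v]
    this is monotone convergence. *)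
Lemma telescope_dominated_cvg (u v : nat -> K) (B : K) :
  (forall n, `|u n.+1 - u n| <= v n.+1 - v n) -> (forall n, v n <= B) ->
  cvgn u.
Proof.
move=> uv vB.
have -> : u = (fun n => u 0%N + series (fun k => u k.+1 - u k) n).
  apply/funext => n; rewrite /series /= telescope_sumr //.
  by rewrite addrC subrK.
apply: is_cvgD; first exact: is_cvg_cst.
apply: (@summable_cvg _ (B - v 0%N)) => n.
apply: (@le_trans _ _ (v n - v 0%N)); last by rewrite lerB.
by rewrite -telescope_sumr //; apply: ler_sum => k _; exact: uv.
Qed.

(** * Unordered sums along an exhaustion by finite sets *)

Lemma sum_fsetD (I : choiceType) (w : I -> K) (A B : {fset I}) :
  (A `<=` B)%fset ->
  \sum_(i <- B) w i = \sum_(i <- A) w i + \sum_(i <- (B `\` A)%fset) w i.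
Proof.
move=> AB; rewrite (big_fsetID _ (mem A)) /=; congr (_ + _).
  have -> // : ([fset x | x in B & x \in A] = A)%fset.
  apply/fsetP => x; rewrite !inE /=.
  by apply/andP/idP => [[]//|xA]; rewrite (fsubsetP AB).
have -> // : ([fset x | x in B & x \notin A] = B `\` A)%fset.
by apply/fsetP => x; rewrite !inE /= andbC.
Qed.

Lemma sum_fset_le (I : choiceType) (w : I -> K) (A B : {fset I}) :
  (forall i, 0 <= w i) -> (A `<=` B)%fset ->
  \sum_(i <- A) w i <= \sum_(i <- B) w i.
Proof. by move=> w0 AB; rewrite (sum_fsetD _ w _ _ AB) lerDl sumr_ge0. Qed.

Lemma exhaustion_fsubset (I : choiceType) (A : nat -> {fset I}) (N : nat)
    (X : {fset I}) :
  (forall m n, (m <= n)%N -> (A m `<=` A n)%fset) ->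
  (forall i, exists n, i \in A n) ->
  exists2 M, (N <= M)%N & (X `<=` A M)%fset.
Proof.
move=> Amono Aex.
exists (maxn N (\max_(i <- X) xchoose (Aex i))); first exact: leq_maxl.
apply/fsubsetP => i iX; have := xchooseP (Aex i).
apply/fsubsetP; apply: Amono; rewrite leq_max; apply/orP; right.
exact: leq_bigmax_seq.
Qed.

(** The absolute sums over the exhaustion converge, so what a finite set adds outside a late [A N]
    is small: unordered summation reaches the limit found along [A]. *)
Lemma partial_sum_cvg (I : choiceType) (w : I -> K) (A : nat -> {fset I})
    (l B : K) :
  (forall m n, (m <= n)%N -> (A m `<=` A n)%fset) ->
  (forall i, exists n, i \in A n) ->
  (forall n, \sum_(i <- A n) `|w i| <= B) ->
  (fun n => \sum_(i <- A n) w i) @ \oo --> l ->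
  summability.partial_sum w @ summability.totally --> l.
Proof.
move=> Amono Aex AB wl.
set G := fun n => \sum_(i <- A n) `|w i| in AB *.
have G_le m n : (m <= n)%N -> G m <= G n.
  by move=> mn; apply: sum_fset_le => //; exact: Amono.
have Gcvg : cvgn G.
  apply: (@telescope_dominated_cvg _ G B) => // n.
  by rewrite ger0_norm // subr_ge0 G_le.
have totallyF := @summability.totally_filter I.
apply/cvgrPdist_lt => e e0.
have e2 : 0 < e / 2 by rewrite divr_gt0.
(* A quarter of [e] for each of [G N] and [G M] keeps [G M - G N] below half of [e]. *)
have e4 : 0 < e / 2 / 2 by rewrite divr_gt0.
move/cvgrPdist_lt: wl => /(_ _ e2) [N1 _ wl].
move/cvgrPdist_lt: Gcvg => /(_ _ e4) [N2 _ Gl].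
pose N := maxn N1 N2.
exists (A N) => // X /= AX.
(* The finite set [X] lies in some later [A M], so the absolute sum over [X] outside [A N] is at
   most [G M - G N]. *)
have [M NM XM] := exhaustion_fsubset _ A N X Amono Aex.
rewrite /summability.partial_sum -(big_seq_fsetE _ _ xpredT w) /=.
rewrite (sum_fsetD _ w _ _ AX) opprD addrA.
apply: (le_lt_trans (ler_normB _ _)); rewrite [e]splitr.
apply: ltrD; first exact: (wl N (leq_maxl _ _)).
apply: (le_lt_trans (ler_norm_sum _ _ _)).
apply: (@le_lt_trans _ _ (G M - G N)).
  rewrite lerBrDl /G -(sum_fsetD _ (fun i => `|w i|) _ _ AX).
  exact: sum_fset_le.
have := ltrD (Gl N (leq_maxr _ _)) (Gl M (leq_trans (leq_maxr _ _) NM)).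
rewrite -splitr => /=; apply: le_lt_trans.
have G0 : 0 <= G M - G N by rewrite subr_ge0 G_le.
rewrite -(ger0_norm G0) distrC [X in _ <= X + _]distrC.
exact: ler_distD.
Qed.

End Completeness.

(** * Finite and infinite q-Pochhammer symbols *)

Section QPochhammer.
Variable K : numFieldType.
Hypothesis summable_cvg : forall (u : nat -> K) (B : K),
  (forall n, \sum_(0 <= k < n) `|u k| <= B) -> cvgn (series u).
Hypothesis prod_bounded : forall c r : K, 0 <= c -> 0 <= r < 1 ->
  exists2 M, 0 <= M & forall n, \prod_(0 <= i < n) (1 + c * r ^+ i) <= M.

Lemma qpochS (a q : K) n : qpoch a q n.+1 = qpoch a q n * (1 - a * q ^+ n).
Proof. by rewrite /qpoch big_nat_recr. Qed.

Lemma qpoch0 (a q : K) : qpoch a q 0 = 1.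
Proof. by rewrite /qpoch big_geq. Qed.

Lemma qpoch_recl (a q : K) n : qpoch a q n.+1 = (1 - a) * qpoch (a * q) q n.
Proof.
rewrite /qpoch big_nat_recl //= expr0 mulr1; congr (_ * _).
by apply: eq_bigr => i _; rewrite exprS mulrA.
Qed.

Variables (q : K) (q1 : `|q| < 1).

Let r01 : 0 <= `|q| < 1. Proof. by rewrite normr_ge0. Qed.

(** The bound is uniform over the disc of radius [c], since later the base runs through
    [c * q ^+ m]. *)
Lemma qpoch_bounded (c : K) : 0 <= c ->
  exists2 M, 0 <= M & forall a n, `|a| <= c -> `|qpoch a q n| <= M.
Proof.
move=> c0; have [M M0 cM] := prod_bounded _ _ c0 r01.
exists M => // a n ac; apply: le_trans (cM n).
rewrite normr_prod; apply: ler_prod => i _; rewrite normr_ge0 /=.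
rewrite (le_trans (ler_normB _ _)) // normr1 lerD2l normrM normrX.
by rewrite ler_wpM2r // exprn_ge0.
Qed.

Lemma qpoch_sub1_series (a : K) n :
  qpoch a q n - 1 = series (fun k => - (a * q ^+ k * qpoch a q k)) n.
Proof.
rewrite /series /= -(qpoch0 a q) -telescope_sumr //.
apply: eq_bigr => i _; rewrite qpochS; ring.
Qed.

(** The factor [|a|] on the right shows that the symbol tends to [1] as [a] tends to [0], uniformly
    in [n]. *)
Lemma qpoch_sub1_bounded (c : K) : 0 <= c ->
  exists2 B, 0 <= B & forall a n, `|a| <= c ->
    \sum_(0 <= k < n) `| - (a * q ^+ k * qpoch a q k)| <= `|a| * B.
Proof.
move=> c0; have [M M0 cM] := qpoch_bounded _ c0.
have d0 : 0 <= (1 - `|q|)^-1 by rewrite invr_ge0 subr_ge0 ltW.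
exists ((1 - `|q|)^-1 * M) => [|a n ac]; first exact: mulr_ge0.
apply: (@le_trans _ _ (\sum_(0 <= k < n) `|a| * (`|q| ^+ k * M))).
  apply: ler_sum => k _; rewrite normrN !normrM normrX -mulrA.
  by rewrite ler_wpM2l // ler_wpM2l ?exprn_ge0 // cM.
rewrite -big_distrr /= -big_distrl /= ler_wpM2l // ler_wpM2r //.
exact: sum_geometric_le.
Qed.

Lemma qpoch_cvg (a : K) : cvgn (qpoch a q).
Proof.
have [B _ aB] := qpoch_sub1_bounded _ (normr_ge0 a).
have -> : qpoch a q =
    (fun n => 1 + series (fun k => - (a * q ^+ k * qpoch a q k)) n).
  by apply/funext => n; rewrite -qpoch_sub1_series addrC subrK.
apply: is_cvgD; first exact: is_cvg_cst.
by apply: (@summable_cvg _ (`|a| * B)) => n; exact: aB.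
Qed.

Lemma qpoch_inf_sub1_bounded (c : K) : 0 <= c ->
  exists2 B, 0 <= B & forall a, `|a| <= c -> `|qpoch_inf a q - 1| <= `|a| * B.
Proof.
move=> c0; have [B B0 cB] := qpoch_sub1_bounded _ c0.
exists B => // a ac.
have a1 : (fun n => qpoch a q n - 1) @ \oo --> qpoch_inf a q - 1.
  by apply: cvgB; [exact: qpoch_cvg | exact: cvg_cst].
apply: (cvgn_norm_le _ _ _ _ a1) => n; rewrite qpoch_sub1_series.
by rewrite (le_trans (ler_norm_sum _ _ _)) // cB.
Qed.

Lemma qpoch_inf_recl (a : K) :
  qpoch_inf a q = (1 - a) * qpoch_inf (a * q) q.
Proof.
apply: cvg_lim => //; rewrite -(cvg_shiftS (qpoch a q)).
have -> : [sequence qpoch a q n.+1]_n = (fun n => (1 - a) * qpoch (a * q) q n).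
  by apply/funext => n; exact: qpoch_recl.
by apply: cvgMl_tmp; exact: qpoch_cvg.
Qed.

Lemma qpoch_inf_split (a : K) n :
  qpoch_inf a q = qpoch a q n * qpoch_inf (a * q ^+ n) q.
Proof.
elim: n => [|n IH]; first by rewrite qpoch0 mul1r expr0 mulr1.
by rewrite IH qpoch_inf_recl qpochS exprSr !mulrA.
Qed.

Lemma norm_q_expr_lt1 n : `|q ^+ n.+1| < 1.
Proof. by rewrite normrX exprn_ilt1. Qed.

Lemma one_sub_q_expr_neq0 n : 1 - q ^+ n.+1 != 0.
Proof.
rewrite subr_eq0 eq_sym; apply: contraTneq (norm_q_expr_lt1 n) => ->.
by rewrite normr1 ltxx.
Qed.

Lemma qpoch_qq_neq0 n : qpoch q q n != 0.
Proof.
elim: n => [|n IH]; first by rewrite qpoch0 oner_eq0.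
by rewrite qpochS mulf_neq0 // -exprS one_sub_q_expr_neq0.
Qed.

(** With [x = q ^+ i.+1], the inverse of [|1 - x|] is at most [1 + |x| / (1 - |x|)], hence at most
    [1 + |q| ^+ i / (1 - |q|)]; the product of these is bounded. *)
Lemma qpoch_qq_inv_bounded :
  exists2 M, 0 <= M & forall n, `|(qpoch q q n)^-1| <= M.
Proof.
have d0 : 0 < 1 - `|q| by rewrite subr_gt0.
have c0 : 0 <= (1 - `|q|)^-1 by rewrite invr_ge0 ltW.
have [M M0 cM] := prod_bounded _ _ c0 r01.
exists M => // n; apply: le_trans (cM n).
rewrite -prodfV normr_prod; apply: ler_prod => i _; rewrite normr_ge0 /=.
rewrite -exprS; set x := q ^+ i.+1.
have x1 : 0 < 1 - `|x| by rewrite subr_gt0 norm_q_expr_lt1.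
have x_le : `|x| <= `|q| ^+ i.
  by rewrite normrX exprS ler_piMl ?exprn_ge0 // ltW.
have x_le_q : `|x| <= `|q|.
  by rewrite normrX exprS ler_piMr // exprn_ile1 // ltW.
apply: (@le_trans _ _ (1 - `|x|)^-1).
  rewrite normfV lef_pV2 ?posrE //.
    by rewrite -[X in X - _](@normr1 K) lerB_dist.
  by rewrite normr_gt0 one_sub_q_expr_neq0.
have -> : (1 - `|x|)^-1 = 1 + (1 - `|x|)^-1 * `|x|.
  by rewrite -[X in _ = X + _](mulVf (lt0r_neq0 x1)) -mulrDr subrK mulr1.
rewrite lerD2l ler_pM //; first by rewrite invr_ge0 ltW.
by rewrite lef_pV2 ?posrE // lerB.
Qed.

End QPochhammer.

(* The first term adds nothing or a plain part [n1]; the second an overlined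
   part [n1], below which parts are less than [n1 - 1]. *)
Definition overpartition_gf (K : numFieldType) (a z q : K) : nat -> K :=
  fix gf n :=
    if n is n1.+1 then
      if n1 is n2.+1 then
        (1 + z * q ^+ n1) * gf n1 + a * z * q ^+ n1 * gf n2
      else 1
    else 0.

(** * The recurrence of the generating function and its limit *)

Section Recurrence.
Variable K : numFieldType.
Hypothesis summable_cvg : forall (u : nat -> K) (B : K),
  (forall n, \sum_(0 <= k < n) `|u k| <= B) -> cvgn (series u).
Hypothesis prod_bounded : forall c r : K, 0 <= c -> 0 <= r < 1 ->
  exists2 M, 0 <= M & forall n, \prod_(0 <= i < n) (1 + c * r ^+ i) <= M.
Variable q : K.
Hypothesis q1 : `|q| < 1.

Local Notation gf := (@overpartition_gf K).

Lemma gfSS (a z p : K) n : gf a z p n.+2 =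
  (1 + z * p ^+ n.+1) * gf a z p n.+1 + a * z * p ^+ n.+1 * gf a z p n.
Proof. by []. Qed.

Lemma gf_nondecreasing (a z p : K) n : 0 <= a -> 0 <= z -> 0 <= p ->
  0 <= gf a z p n <= gf a z p n.+1.
Proof.
move=> a0 z0 p0; have az0 := mulr_ge0 a0 z0.
elim: n => [|n /andP[gn gnn]]; first by rewrite lexx ler01.
have gn1 := le_trans gn gnn; rewrite gn1 gfSS mulrDl mul1r -addrA lerDl.
by rewrite addr_ge0 // mulr_ge0 // mulr_ge0 // exprn_ge0.
Qed.

(** Replacing [gf n] by the larger [gf n.+1] in the recurrence multiplies by
    [1 + (z + a * z) * p ^+ n.+1] at most; lowering the exponent to [n] matches the bounded
    product. *)
Lemma gf_bounded (a z p : K) : 0 <= a -> 0 <= z -> 0 <= p < 1 ->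
  exists B, forall n, gf a z p n <= B.
Proof.
move=> a0 z0 p01; have /andP[p0 p1] := p01; have az0 := mulr_ge0 a0 z0.
have [M M0 cM] := prod_bounded _ _ (addr_ge0 z0 az0) p01.
exists M => -[//|n]; apply: le_trans (cM n); elim: n => [|n IH].
  by rewrite big_geq.
have /andP[gn gnn] := gf_nondecreasing a z p n a0 z0 p0.
rewrite big_nat_recr // [leRHS]mulrC.
have c0 : 0 <= 1 + (z + a * z) * p ^+ n.
  by rewrite addr_ge0 // mulr_ge0 ?exprn_ge0 // addr_ge0.
apply: (le_trans _ (ler_wpM2l c0 IH)); rewrite gfSS !mulrDl -addrA.
have pn : p ^+ n.+1 <= p ^+ n by rewrite exprS ler_piMl ?exprn_ge0 // ltW.
have gn1 := le_trans gn gnn.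
rewrite lerD2l lerD //; first by rewrite ler_wpM2r // ler_wpM2l.
by apply: ler_pM => //; [rewrite mulr_ge0 ?exprn_ge0|rewrite ler_wpM2l].
Qed.

Lemma norm_gf_le (a z p : K) n : `|gf a z p n| <= gf `|a| `|z| `|p| n.
Proof.
have [n0] := ubnP n; elim: n0 n => // n0 IH [|[|n]] //=; rewrite ?normr0 ?normr1 //.
rewrite ltnS => n0n; rewrite (le_trans (ler_normD _ _)) // !normrM.
have IH1 := IH n.+1 n0n; have IH2 := IH n (ltnW n0n).
rewrite lerD //; last by rewrite !normrX ler_wpM2l // !mulr_ge0 ?exprn_ge0.
apply: ler_pM => //.
by rewrite (le_trans (ler_normD _ _)) // normr1 normrM normrX.
Qed.

(** The increments are dominated by those of the same recurrence at the norms of [a], [z] and [q],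
    which stays bounded. *)
Lemma gf_cvg (a z : K) : cvgn (gf a z q).
Proof.
have q01 : 0 <= `|q| < 1 by rewrite normr_ge0.
have [B gB] := gf_bounded _ _ _ (normr_ge0 a) (normr_ge0 z) q01.
apply: (@telescope_dominated_cvg _ summable_cvg _ (gf `|a| `|z| `|q|) B) => //.
(* At index [0] both sequences jump from [0] to [1]; the recurrence governs the increments only from
   index [1] on. *)
case=> [|n]; first by rewrite /= !subr0 normr1.
have E (a' z' p : K) : gf a' z' p n.+2 - gf a' z' p n.+1 =
    z' * p ^+ n.+1 * gf a' z' p n.+1 + a' * z' * p ^+ n.+1 * gf a' z' p n.
  by rewrite gfSS; ring.
rewrite !E (le_trans (ler_normD _ _)) // !normrM !normrX.
by rewrite lerD // ler_wpM2l ?norm_gf_le // ?mulr_ge0 // exprn_ge0.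
Qed.

(** Expanding [x N] makes the coefficient of [x N.+1] the right side of the recurrence of [gf]. The
    value [gf 0 = 0] starts the induction. *)
Lemma gf_telescope (a z : K) (x : nat -> K) :
  (forall N, x N = (1 + z * q ^+ N.+1) * x N.+1 +
                   a * z * q ^+ N.+2 * x N.+2) ->
  forall N, x 0%N = gf a z q N.+1 * x N +
                    a * z * q ^+ N.+1 * gf a z q N * x N.+1.
Proof.
move=> xE; elim=> [|N IH]; first by rewrite /= mul1r mulr0 mul0r addr0.
by rewrite IH {1}xE gfSS; ring.
Qed.

(** In [gf_telescope] the second term carries [q ^+ N.+1] and vanishes in the limit, while the left
    side does not depend on [N]. *)
Lemma gf_recurrence_limit (a z l : K) (x : nat -> K) :
  (forall N, x N = (1 + z * q ^+ N.+1) * x N.+1 +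
                   a * z * q ^+ N.+2 * x N.+2) ->
  x @ \oo --> l -> x 0%N = limn (gf a z q) * l.
Proof.
move=> xE xl; have gE := gf_telescope a z x xE.
set F := limn _.
have gF : gf a z q @ \oo --> F by exact: gf_cvg.
have gF1 : (fun N => gf a z q N.+1) @ \oo --> F.
  by rewrite (cvg_shiftS (gf a z q)).
have xl1 : (fun N => x N.+1) @ \oo --> l by rewrite (cvg_shiftS x).
have q0 : (fun N => q ^+ N.+1) @ \oo --> (0 : K).
  by rewrite (cvg_shiftS (fun N => q ^+ N)); exact: (cvgn_expr _ summable_cvg).
have R : (fun N => gf a z q N.+1 * x N +
                   a * z * q ^+ N.+1 * gf a z q N * x N.+1) @ \oo -->
    F * l + a * z * 0 * F * l.
  apply: cvgD; first exact: cvgM.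
  by apply: cvgM xl1; apply: cvgM gF; exact: cvgMl_tmp.
(* The vanishing term is written back in the shape given by [R], so that uniqueness of limits
   applies to a constant sequence. *)
rewrite -[RHS]addr0 -[X in _ + X](mul0r l) -[X in _ + X * _](mul0r F).
rewrite -(mulr0 (a * z)); apply: cvg_unique R => //.
have -> : (fun N => gf a z q N.+1 * x N +
                    a * z * q ^+ N.+1 * gf a z q N * x N.+1) =
    (fun=> x 0%N) by apply/funext => N; rewrite -gE.
exact: cvg_cst.
Qed.

Lemma summable_mul_cvg (c t : nat -> K) (B M : K) :
  (forall n, \sum_(0 <= k < n) `|c k| <= B) -> (forall n, `|t n| <= M) ->
  cvgn (series (fun n => c n * t n)).
Proof.
move=> cB tM; have M0 := le_trans (normr_ge0 _) (tM 0%N).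
apply: (@summable_cvg _ (B * M)) => n.
apply: le_trans (ler_wpM2r M0 (cB n)).
rewrite big_distrl /=; apply: ler_sum => k _.
by rewrite normrM ler_wpM2l.
Qed.

Lemma norm_q_exprM_le1 N n : `|(q ^+ N) ^+ n| <= 1.
Proof. by rewrite !normrX -exprM exprn_ile1 // ltW. Qed.

Lemma q_power_series_cvg (c : nat -> K) (B : K) N :
  (forall n, \sum_(0 <= k < n) `|c k| <= B) ->
  cvgn (series (fun n => c n * (q ^+ N) ^+ n)).
Proof. by move=> cB; apply: summable_mul_cvg cB (norm_q_exprM_le1 N). Qed.

Lemma q_power_series_limit (c : nat -> K) (B : K) :
  (forall n, \sum_(0 <= k < n) `|c k| <= B) ->
  (fun N => limn (series (fun n => c n * (q ^+ N) ^+ n))) @ \oo --> c 0%N.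
Proof.
(* [s] is the limit of [(q ^+ N) ^+ n] as [N] grows: only the constant term survives, and the error
   is at most [|q| ^+ N] for every [n]. *)
move=> cB; set s := fun n => (n == 0%N)%:R : K.
have sc : series (fun n => c n * s n) @ \oo --> c 0%N.
  rewrite -(cvg_shiftS (series _)).
  have -> : [sequence series (fun n => c n * s n) n.+1]_n = (fun=> c 0%N).
    apply/funext => n; rewrite /series /= big_nat_recl //= big1 => [|i _].
      by rewrite mulr1 addr0.
    by rewrite mulr0.
  exact: cvg_cst.
rewrite -[c 0%N](cvg_lim _ sc) //.
apply: (dominated_series_cvg _ _ B _ _ (fun N => `|q| ^+ N)) => //.
- move=> N [|n]; first by rewrite /s subrr normr0 exprn_ge0.
  by rewrite /s sub0r normrN exprSr normrM [X in _ * X]normrX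
     ler_piMl ?exprn_ge0 // norm_q_exprM_le1.
- by apply: (cvgn_expr _ summable_cvg); rewrite normr_id.
- by move=> N; exact: q_power_series_cvg cB.
- by apply/cvg_ex; exists (c 0%N).
Qed.

End Recurrence.

(** * Enumeration of strict overpartitions by largest part *)

Section Enumeration.
Local Open Scope nat_scope.

(* An overlined part [m] above a part [m'] satisfies [m' + 1 < m], a plain one
   [m' < m]; reading [m' = 0] past the end covers the smallest part too. *)
Lemma is_strict_overpartition_cons m o s :
  is_strict_overpartition ((m, o) :: s) =
  is_strict_overpartition s && (part s 0 + o < m).
Proof.
rewrite /is_strict_overpartition.
have -> : [forall i : 'I_(size ((m, o) :: s)), overlined ((m, o) :: s) i ==>
      (2 <= part ((m, o) :: s) i) &&
      (2 <= part ((m, o) :: s) i - part ((m, o) :: s) i.+1)] =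
    (o ==> (2 <= m - part s 0)) && [forall i : 'I_(size s),
      overlined s i ==> (2 <= part s i) && (2 <= part s i - part s i.+1)].
  apply/forallP/andP => [H|[H0 /forallP Hs] [[|i] /= iP]].
  - split; first by have := H ord0; rewrite /overlined /part /=; lia.
    by apply/forallP => i; exact: (H (lift ord0 i)).
  - by move: H0; rewrite /overlined /part /=; lia.
  - exact: (Hs (Ordinal (iP : i < size s))).
case: s => [|[m' o'] s] /=; rewrite /part /=; first by case: o; lia.
by rewrite -!andbA; case: o; lia.
Qed.

(** The recursion mirrors [overpartition_gf]. Level [0] lacks even the empty overpartition, whose
    largest part reads as [0]; this also excludes an overlined part [1]. *)
Fixpoint overpartitions_lt (n : nat) : seq (seq (nat * bool)) :=
  if n is n1.+1 then
    if n1 is n2.+1 then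
      overpartitions_lt n1 ++ map (cons (n1, false)) (overpartitions_lt n1) ++
      map (cons (n1, true)) (overpartitions_lt n2)
    else [:: [::]]
  else [::].
#[global] Arguments overpartitions_lt n : simpl never.

Lemma overpartitions_ltSS n : overpartitions_lt n.+2 =
  overpartitions_lt n.+1 ++
  map (cons (n.+1, false)) (overpartitions_lt n.+1) ++
  map (cons (n.+1, true)) (overpartitions_lt n).
Proof. by []. Qed.

Lemma mem_map_cons (T : eqType) (x : T) (s : seq T) (ss : seq (seq T)) :
  (s \in map (cons x) ss) = if s is y :: s' then (y == x) && (s' \in ss)
                            else false.
Proof.
case: s => [|y s]; first by apply/mapP => -[].
apply/mapP/andP => [[s' s'ss [-> ->]]|[/eqP -> sss]]; first by rewrite eqxx.
by exists s.
Qed.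

(** Below a head [n.+1] the parts are less than [n.+1] if it is plain and less than [n] if it is
    overlined, which are the last two blocks. *)
Lemma mem_overpartitions_lt n s :
  (s \in overpartitions_lt n) = is_strict_overpartition s && (part s 0 < n).
Proof.
have [n0] := ubnP n; elim: n0 n s => // n0 IH [|[|n]] s n_lt.
- by rewrite ltn0 andbF.
- rewrite inE; case: s => [|[m o] s].
    by rewrite /is_strict_overpartition /= andbT; apply/esym/forallP => -[].
  rewrite is_strict_overpartition_cons [part (_ :: _) 0]/part /=.
  by apply/esym/negP => /andP[/andP[_]]; lia.
- rewrite overpartitions_ltSS !mem_cat !mem_map_cons IH //.
  case: s => [|[m o] s]; first by rewrite /part /= !orbF.
  rewrite !IH //; last exact: ltnW.
  rewrite is_strict_overpartition_cons !xpair_eqE.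
  rewrite [part ((m, o) :: s) 0]/part /=.
  by case: (is_strict_overpartition s); case: o => /=; lia.
Qed.

Lemma overpartitions_lt_uniq n : uniq (overpartitions_lt n).
Proof.
have [n0] := ubnP n; elim: n0 n => // n0 IH [|[|n]] // n_lt.
have cons_inj (x : nat * bool) : injective (cons x) by move=> s t [].
rewrite overpartitions_ltSS !cat_uniq !map_inj_uniq //.
rewrite !IH //=; last exact: ltnW.
rewrite andbT; apply/andP; split; apply/hasPn => s.
  (* Lists in the two later blocks start with [n.+1], too large for the first block. *)
  rewrite mem_cat !mem_map_cons; case: s => [//|[m o] s].
  rewrite /= !mem_overpartitions_lt !xpair_eqE => H.
  have -> : m = n.+1 by case/orP: H => /andP[/andP[/eqP]].
  by rewrite ltnn andbF.
rewrite /= !mem_map_cons; case: s => [//|[m o] s].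
by rewrite !xpair_eqE; case: o; lia.
Qed.

Definition overpartition_fset (n : nat) : {fset strict_overpartition} :=
  seq_fset tt (pmap insub (overpartitions_lt n)).

Lemma in_overpartition_fset n (l : strict_overpartition) :
  (l \in overpartition_fset n) = (part l 0 < n).
Proof.
rewrite seq_fsetE mem_pmap_sub mem_overpartitions_lt.
by rewrite (valP l).
Qed.

End Enumeration.

(** * Weights and their sums over the enumeration *)

Section Weight.
Variable K : numFieldType.

(** Defined on bare lists so that sums can follow the recursion of [overpartitions_lt]. *)
Definition overpartition_weight (a z q : K) (s : seq (nat * bool)) : K :=
  a ^+ count (fun p => p.2) s * z ^+ size s *
  q ^+ sumn [seq p.1 | p <- s].

Lemma overpartition_weight_cons (a z q : K) m o s :
  overpartition_weight a z q ((m, o) :: s) =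
  a ^+ o * z * q ^+ m * overpartition_weight a z q s.
Proof. by rewrite /overpartition_weight /= !exprD exprS; ring. Qed.

Lemma norm_overpartition_weight (a z q : K) s :
  `|overpartition_weight a z q s| = overpartition_weight `|a| `|z| `|q| s.
Proof. by rewrite /overpartition_weight !normrM !normrX. Qed.

Lemma sum_overpartitions_lt (a z q : K) n :
  \sum_(s <- overpartitions_lt n) overpartition_weight a z q s =
  overpartition_gf K a z q n.
Proof.
have [n0] := ubnP n; elim: n0 n => // n0 IH [|[|n]] n_lt.
- by rewrite big_nil.
- by rewrite big_seq1 /overpartition_weight /= !expr0 !mulr1.
rewrite overpartitions_ltSS !big_cat [LHS]/= !big_map.
under [X in _ + (X + _)]eq_bigr do rewrite overpartition_weight_cons.
under [X in _ + (_ + X)]eq_bigr do rewrite overpartition_weight_cons.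
rewrite -!big_distrr [LHS]/= !IH //; last exact: ltnW.
by rewrite gfSS [a ^+ false]expr0 [a ^+ true]expr1; ring.
Qed.

Lemma sum_overpartition_fset (a z q : K) n :
  \sum_(l <- overpartition_fset n) overpartition_weight a z q (sop_seq l) =
  overpartition_gf K a z q n.
Proof.
rewrite (perm_big _ (seq_fset_perm tt _)) undup_id /=; last first.
  exact/pmap_sub_uniq/overpartitions_lt_uniq.
rewrite -(big_map sop_seq xpredT) -sum_overpartitions_lt.
have -> // : map sop_seq (pmap insub (overpartitions_lt n)) =
  overpartitions_lt n.
(* [insub] discards nothing, as every enumerated list is a strict overpartition. *)
rewrite (pmap_filter (insubK _)); apply/all_filterP/allP => s.
by rewrite isSome_insub mem_overpartitions_lt => /andP[].
Qed.

End Weight.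

(** * The first series *)

Section Identities.
Variable K : numFieldType.
Hypothesis summable_cvg : forall (u : nat -> K) (B : K),
  (forall n, \sum_(0 <= k < n) `|u k| <= B) -> cvgn (series u).
Hypothesis prod_bounded : forall c r : K, 0 <= c -> 0 <= r < 1 ->
  exists2 M, 0 <= M & forall n, \prod_(0 <= i < n) (1 + c * r ^+ i) <= M.
Variable q : K.
Hypothesis q1 : `|q| < 1.

Lemma triangularS n : (n.+1 * (n.+1 + 1) %/ 2 = n * (n + 1) %/ 2 + n.+1)%N.
Proof.
have -> : (n.+1 * (n.+1 + 1) = n.+1 * 2 + n * (n + 1))%N by lia.
by rewrite divnMDl // addnC.
Qed.

(* The left-hand terms are single terms in the expansion of the product. *)
Lemma sum_triangular_le (x r : K) n : 0 <= x -> 0 <= r ->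
  \sum_(0 <= k < n.+1) x ^+ k * r ^+ (k * (k + 1) %/ 2)%N <=
  \prod_(0 <= i < n) (1 + x * r * r ^+ i).
Proof.
move=> x0 r0.
have t0 k : 0 <= x ^+ k * r ^+ (k * (k + 1) %/ 2)%N.
  by rewrite mulr_ge0 ?exprn_ge0.
elim: n => [|n IH]; first by rewrite big_nat1 big_geq // mul0n div0n !expr0 mulr1.
rewrite big_nat_recr // [leRHS]big_nat_recr //= mulrDr mulr1 lerD //.
rewrite triangularS exprD exprS -mulrA -[r ^+ n.+1]/(r ^+ n.+1) exprS.
have -> : x * (x ^+ n * (r ^+ (n * (n + 1) %/ 2)%N * (r * r ^+ n))) =
    (x ^+ n * r ^+ (n * (n + 1) %/ 2)%N) * (x * r * r ^+ n) by ring.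
rewrite ler_wpM2r ?mulr_ge0 ?exprn_ge0 //; apply: le_trans IH.
by rewrite big_nat_recr //= lerDr sumr_ge0.
Qed.

Section FirstSeries.
Variables a z : K.

Let u n : K :=
  qpoch (- a * q) q n / qpoch q q n * z ^+ n * q ^+ (n * (n + 1) %/ 2)%N.

Let uS n : (1 - q ^+ n.+1) * u n.+1 = z * q ^+ n.+1 * (1 + a * q ^+ n.+1) * u n.
Proof.
rewrite /u triangularS exprD !qpochS invfM -exprS [z ^+ n.+1]exprS.
have q0 := one_sub_q_expr_neq0 _ _ q1 n.
have -> : 1 - - a * q * q ^+ n = 1 + a * q ^+ n.+1 by rewrite exprS; ring.
rewrite -[RHS](mulfK q0); ring.
Qed.

Lemma first_series_summable :
  exists B, forall n, \sum_(0 <= k < n) `|u k| <= B.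
Proof.
have q01 : 0 <= `|q| < 1 by rewrite normr_ge0.
have [M1 M10 qM1] := qpoch_bounded _ prod_bounded _ q1 _ (normr_ge0 (- a * q)).
have [M2 M20 qM2] := qpoch_qq_inv_bounded _ prod_bounded _ q1.
have [M3 M30 qM3] :=
  prod_bounded _ _ (mulr_ge0 (normr_ge0 z) (normr_ge0 q)) q01.
exists (M1 * M2 * M3) => n.
apply: (@le_trans _ _ (\sum_(0 <= k < n.+1) `|u k|)).
  by rewrite [leRHS]big_nat_recr //= lerDl.
apply: le_trans (ler_wpM2l (mulr_ge0 M10 M20) (qM3 n)).
apply: (le_trans _ (ler_wpM2l (mulr_ge0 M10 M20)
                     (sum_triangular_le _ _ n (normr_ge0 z) (normr_ge0 q)))).
rewrite big_distrr /=; apply: ler_sum => k _.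
rewrite /u -mulrA !normrM !normrX ler_wpM2r ?mulr_ge0 ?exprn_ge0 //.
by apply: ler_pM => //; exact: qM1.
Qed.

Let S N := limn (series (fun n => u n * (q ^+ N) ^+ n)).

(** Multiplying [uS] by [Q ^+ n.+1] expresses the term of index [n.+1] through [u n]; this shift
    shortens the last two partial sums by one term and leaves no remainder. *)
Let partialS Q m : series (fun n => u n * Q ^+ n) m.+1 =
  series (fun n => u n * (q * Q) ^+ n) m.+1 +
  z * (q * Q) * series (fun n => u n * (q * Q) ^+ n) m +
  a * z * (q * (q * Q)) * series (fun n => u n * (q * (q * Q)) ^+ n) m.
Proof.
elim: m => [|m IH].
  by rewrite /series /= !big_nat1 !big_geq // !mulr0 !addr0 !expr0.
rewrite seriesSr IH [in RHS]seriesSr ![series _ m.+1]seriesSr.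
have -> : u m.+1 * Q ^+ m.+1 = u m.+1 * (q * Q) ^+ m.+1 +
    z * q ^+ m.+1 * (1 + a * q ^+ m.+1) * u m * Q ^+ m.+1.
  by rewrite -uS exprMn; ring.
rewrite !exprMn !exprS; ring.
Qed.

Lemma first_series_rec N :
  S N = (1 + z * q ^+ N.+1) * S N.+1 + a * z * q ^+ N.+2 * S N.+2.
Proof.
have [B uB] := first_series_summable.
have Scvg M : series (fun n => u n * (q ^+ M) ^+ n) @ \oo --> S M.
  exact: (q_power_series_cvg _ summable_cvg _ q1 _ B M uB).
have S1 : (fun m => series (fun n => u n * (q ^+ N) ^+ n) m.+1) @ \oo --> S N.
  by rewrite (cvg_shiftS (series _)).
have S2 : (fun m => series (fun n => u n * (q ^+ N.+1) ^+ n) m.+1) @ \oo -->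
    S N.+1 by rewrite (cvg_shiftS (series _)).
rewrite mulrDl mul1r; apply: cvg_unique S1 _ => //.
have -> : (fun m => series (fun n => u n * (q ^+ N) ^+ n) m.+1) = (fun m =>
    series (fun n => u n * (q ^+ N.+1) ^+ n) m.+1 +
    z * q ^+ N.+1 * series (fun n => u n * (q ^+ N.+1) ^+ n) m +
    a * z * q ^+ N.+2 * series (fun n => u n * (q ^+ N.+2) ^+ n) m).
  by apply/funext => m; rewrite partialS -!exprS.
by apply: cvgD; [apply: cvgD => //|]; exact: cvgMl_tmp.
Qed.

Lemma first_series_eq : limn (series u) = limn (overpartition_gf K a z q).
Proof.
have [B uB] := first_series_summable.
have S1 : S @ \oo --> (1 : K).
  have -> : 1 = u 0%N.
    by rewrite /u !qpoch0 mul0n div0n !expr0 invr1 !mulr1.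
  exact: (q_power_series_limit _ summable_cvg _ q1 _ B uB).
have := gf_recurrence_limit _ summable_cvg prod_bounded _ q1 a z _ _
  first_series_rec S1.
rewrite mulr1 => <-; congr (limn (series _)).
by apply/funext => n; rewrite expr0 expr1n mulr1.
Qed.

End FirstSeries.

(** * The second series and Euler's identity *)

Section SecondSeries.
Variables b c : K.
Hypothesis b1 : `|b| < 1.

Let beta n : K := b ^+ n / qpoch q q n.
Let T m : K := qpoch_inf (c * q ^+ m) q.

Let betaS n : (1 - q ^+ n.+1) * beta n.+1 = b * beta n.
Proof.
rewrite /beta qpochS invfM -exprS [b ^+ n.+1]exprS.
rewrite -[RHS](mulfK (one_sub_q_expr_neq0 _ _ q1 n)); ring.
Qed.

Lemma second_series_summable :
  exists B, forall n, \sum_(0 <= k < n) `|beta k| <= B.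
Proof.
have [M M0 qM] := qpoch_qq_inv_bounded _ prod_bounded _ q1.
exists ((1 - `|b|)^-1 * M) => n.
have b01 : 0 <= `|b| < 1 by rewrite normr_ge0.
apply: (le_trans _ (ler_wpM2r M0 (sum_geometric_le _ _ n b01))).
rewrite big_distrl /=; apply: ler_sum => k _.
by rewrite normrM normrX ler_wpM2l ?exprn_ge0.
Qed.

Let TS m : T m = (1 - c * q ^+ m) * T m.+1.
Proof.
by rewrite /T (qpoch_inf_recl _ summable_cvg prod_bounded _ q1) exprSr mulrA.
Qed.

Lemma qpoch_inf_tail_sub1_le :
  exists2 B, 0 <= B & forall m, `|T m - 1| <= `|q| ^+ m * B.
Proof.
have [B B0 cB] :=
  qpoch_inf_sub1_bounded _ summable_cvg prod_bounded _ q1 _ (normr_ge0 c).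
exists (`|c| * B) => [|m]; first by rewrite mulr_ge0.
rewrite mulrA [_ ^+ m * _]mulrC -normrX -normrM; apply: cB.
by rewrite normrM normrX ler_piMr // exprn_ile1 // ltW.
Qed.

Lemma qpoch_inf_tail_bounded : exists M, forall m, `|T m| <= M.
Proof.
have [B B0 TB] := qpoch_inf_tail_sub1_le.
exists (B + 1) => m; rewrite -[T m](subrK 1) (le_trans (ler_normD _ _)) //.
by rewrite normr1 lerD2r (le_trans (TB m)) // ler_piMl // exprn_ile1 // ltW.
Qed.

Let X N := limn (series (fun n => beta n * T (n + N)%N)).

Lemma second_series_cvg N : series (fun n => beta n * T (n + N)%N) @ \oo --> X N.
Proof.
have [B betaB] := second_series_summable; have [M TM] := qpoch_inf_tail_bounded.
exact: (summable_mul_cvg _ summable_cvg _ _ B M betaB (fun n => TM (n + N)%N)).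
Qed.

(** The factor [1 - c * q ^+ (n + N)] of [T (n + N)] equals [(1 - c * q ^+ N) + c * q ^+ N * (1 - q
    ^+ n)], and by [betaS] the factor [1 - q ^+ n] lowers the index of [beta]. *)
Let partialX N m : series (fun n => beta n * T (n + N)%N) m.+1 =
  (1 - c * q ^+ N) * series (fun n => beta n * T (n + N.+1)%N) m.+1 +
  b * c * q ^+ N * series (fun n => beta n * T (n + N.+2)%N) m.
Proof.
elim: m => [|m IH].
  rewrite /series /= !big_nat1 big_geq // mulr0 addr0 !add0n TS; ring.
rewrite seriesSr IH [series (fun n => _ * T (n + N.+1)%N) m.+2]seriesSr.
rewrite [series (fun n => _ * T (n + N.+2)%N) m.+1]seriesSr.
have -> : T (m.+1 + N)%N = (1 - c * (q ^+ m.+1 * q ^+ N)) * T (m.+1 + N.+1)%N.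
  by rewrite -exprD TS addnS.
rewrite -[(m + N.+2)%N]addSnnS.
set A := series _ m.+1; set B := series _ m.
set t := T _; rewrite !mulrDr.
have -> : b * c * q ^+ N * (beta m * t) = b * beta m * (c * q ^+ N * t) by ring.
by rewrite -betaS; ring.
Qed.

Lemma second_series_rec N :
  X N = (1 - c * q ^+ N) * X N.+1 + b * c * q ^+ N * X N.+2.
Proof.
have X1 : (fun m => series (fun n => beta n * T (n + N)%N) m.+1) @ \oo --> X N.
  by rewrite (cvg_shiftS (series _)); exact: second_series_cvg.
have X2 : (fun m => series (fun n => beta n * T (n + N.+1)%N) m.+1) @ \oo -->
    X N.+1 by rewrite (cvg_shiftS (series _)); exact: second_series_cvg.
apply: cvg_unique X1 _ => //.
have -> : (fun m => series (fun n => beta n * T (n + N)%N) m.+1) = (fun m =>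
    (1 - c * q ^+ N) * series (fun n => beta n * T (n + N.+1)%N) m.+1 +
    b * c * q ^+ N * series (fun n => beta n * T (n + N.+2)%N) m).
  by apply/funext => m; exact: partialX.
by apply: cvgD; apply: cvgMl_tmp; [|exact: second_series_cvg].
Qed.

(** [T (n + N)] tends to [1] at a rate [|q| ^+ N] uniform in [n], so dominated convergence
    applies. *)
Lemma second_series_limit : X @ \oo --> limn (series beta).
Proof.
have [B betaB] := second_series_summable.
have [D D0 TD] := qpoch_inf_tail_sub1_le.
have betaE : beta = (fun n => beta n * 1) by apply/funext => n; rewrite mulr1.
have -> : limn (series beta) = limn (series (fun n => beta n * 1)).
  by rewrite -betaE.
apply: (dominated_series_cvg _ beta B (fun N n => T (n + N)%N) (fun=> 1)
  (fun N => `|q| ^+ N * D) betaB).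
- move=> N n; rewrite distrC (le_trans (TD _)) // ler_wpM2r // exprD.
  by rewrite ler_piMl ?exprn_ge0 // exprn_ile1 // ltW.
- rewrite -[X in _ --> X](mul0r D); apply: cvgMr_tmp.
  by apply: (cvgn_expr _ summable_cvg); rewrite normr_id.
- by move=> N; exact: cvgP (second_series_cvg N).
- by rewrite -betaE; apply: summable_cvg betaB.
Qed.

(** The sum [e N] of [beta n * (q ^+ N) ^+ n] satisfies [e N.+1 = e N * (1 - b * q ^+ N)], hence
    [e N = qpoch b q N * e 0]; letting [N] grow, [e N] tends to [beta 0 = 1]. *)
Lemma euler_identity : qpoch_inf b q * limn (series beta) = 1.
Proof.
have [B betaB] := second_series_summable.
pose e N := limn (series (fun n => beta n * (q ^+ N) ^+ n)).
have ecvg N : series (fun n => beta n * (q ^+ N) ^+ n) @ \oo --> e N.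
  exact: (q_power_series_cvg _ summable_cvg _ q1 _ B N betaB).
have partial_e Q m : series (fun n => beta n * (q * Q) ^+ n) m.+1 =
    series (fun n => beta n * Q ^+ n) m.+1 -
    b * Q * series (fun n => beta n * Q ^+ n) m.
  elim: m => [|m IH].
    by rewrite /series /= !big_nat1 big_geq // mulr0 subr0 !expr0.
  rewrite seriesSr IH [in RHS]seriesSr ![series _ m.+1]seriesSr.
  have -> : beta m.+1 * (q * Q) ^+ m.+1 =
      beta m.+1 * Q ^+ m.+1 - b * beta m * Q ^+ m.+1.
    by rewrite -betaS exprMn; ring.
  rewrite exprS; ring.
have eS N : e N.+1 = e N * (1 - b * q ^+ N).
  have e1 : (fun m => series (fun n => beta n * (q ^+ N.+1) ^+ n) m.+1)
      @ \oo --> e N.+1 by rewrite (cvg_shiftS (series _)).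
  have e2 : (fun m => series (fun n => beta n * (q ^+ N) ^+ n) m.+1)
      @ \oo --> e N by rewrite (cvg_shiftS (series _)).
  rewrite mulrBr mulr1 [e N * (b * _)]mulrC; apply: cvg_unique e1 _ => //.
  have -> : (fun m => series (fun n => beta n * (q ^+ N.+1) ^+ n) m.+1) =
      (fun m => series (fun n => beta n * (q ^+ N) ^+ n) m.+1 -
        b * q ^+ N * series (fun n => beta n * (q ^+ N) ^+ n) m).
    by apply/funext => m; rewrite exprS partial_e.
  by apply: cvgB => //; exact: cvgMl_tmp.
have eE N : e N = qpoch b q N * e 0%N.
  by elim: N => [|N IH]; rewrite ?qpoch0 ?mul1r // eS IH qpochS; ring.
have e_lim : e @ \oo --> (1 : K).
  have -> : 1 = beta 0%N by rewrite /beta qpoch0 expr0 invr1 mulr1.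
  exact: (q_power_series_limit _ summable_cvg _ q1 _ B betaB).
have -> : series beta = series (fun n => beta n * (q ^+ 0) ^+ n).
  by congr series; apply/funext => n; rewrite expr0 expr1n mulr1.
apply: cvg_unique e_lim => //.
have -> : e = (fun N => qpoch b q N * e 0%N) by apply/funext.
by apply: cvgMr_tmp; exact: (qpoch_cvg _ summable_cvg prod_bounded _ q1).
Qed.

End SecondSeries.

(** The tails tend to [1], so some tail is nonzero, and the finite product before it is nonzero by
    hypothesis. *)
Lemma qpoch_inf_neq0 (c : K) :
  (forall n, qpoch c q n != 0) -> qpoch_inf c q != 0.
Proof.
move=> c_neq0; have [B B0 cB] := qpoch_inf_tail_sub1_le c.
have T1 : (fun m => qpoch_inf (c * q ^+ m) q) @ \oo --> (1 : K).
  apply: (cvgn_squeeze _ _ (fun m => `|q| ^+ m * B)); last first.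
    by move=> m; rewrite distrC.
  rewrite -[X in _ --> X](mul0r B); apply: cvgMr_tmp.
  by apply: (cvgn_expr _ summable_cvg); rewrite normr_id.
move/cvgrPdist_lt: T1 => /(_ 1 ltr01) [m _ /(_ m (leqnn m)) /= Tm].
rewrite (qpoch_inf_split _ summable_cvg prod_bounded _ q1 _ m).
rewrite mulf_neq0 //; apply: contraTneq Tm => ->.
by rewrite subr0 normr1 ltxx.
Qed.

Lemma second_series_eq (a z : K) : `|a * q| < 1 ->
  (forall k, 1 + z * q ^+ k.+1 != 0) ->
  let v := fun n => (- a * q) ^+ n / (qpoch q q n * qpoch (- z * q) q n) in
  cvgn (series v) /\ limn (overpartition_gf K a z q) =
    qpoch_inf (- a * q) q * qpoch_inf (- z * q) q * limn (series v).
Proof.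
move=> aq1 z_neq0 v; set b := - a * q; set c := - z * q.
have b1 : `|b| < 1 by rewrite /b mulNr normrN.
have c_neq0 n : qpoch c q n != 0.
  elim: n => [|n IH]; first by rewrite qpoch0 oner_eq0.
  rewrite qpochS mulf_neq0 // /c (_ : 1 - _ = 1 + z * q ^+ n.+1) //.
  by rewrite exprS; ring.
have Tc_neq0 := qpoch_inf_neq0 c c_neq0.
pose beta n := b ^+ n / qpoch q q n.
pose X N := limn (series (fun n => beta n * qpoch_inf (c * q ^+ (n + N)) q)).
have XE : X 0%N = limn (overpartition_gf K a z q) * limn (series beta).
  apply: (gf_recurrence_limit _ summable_cvg prod_bounded _ q1).
    move=> N; rewrite /X (second_series_rec b c b1) /b /c !exprS.
    by congr (_ * _ + _ * _); ring.
  exact: second_series_limit.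
have X0cvg : series (fun n => beta n * qpoch_inf (c * q ^+ (n + 0)) q) @ \oo -->
  X 0%N by exact: (second_series_cvg b c b1 0).
have vE : series v = (fun m => (qpoch_inf c q)^-1 *
    series (fun n => beta n * qpoch_inf (c * q ^+ (n + 0)) q) m).
  apply/funext => m; rewrite /series /= big_distrr /=.
  apply: eq_bigr => n _; rewrite addn0 /v /beta -/b -/c.
  have T0E := qpoch_inf_split _ summable_cvg prod_bounded _ q1 c n.
  (* The tail divides the nonzero infinite product, so it can be cancelled. *)
  have := Tc_neq0; rewrite T0E mulf_eq0 negb_or => /andP[_ Tn].
  by rewrite !invfM -[LHS](mulfK Tn); ring.
have v_cvg : series v @ \oo --> (qpoch_inf c q)^-1 * X 0%N.
  by rewrite vE; exact: cvgMl_tmp.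
split; first exact: cvgP v_cvg.
rewrite (cvg_lim _ v_cvg) // XE -mulrA mulVKf //.
by rewrite mulrCA (euler_identity b b1) mulr1.
Qed.

(** The sets with largest part less than [n] exhaust all strict overpartitions, and their sums are
    [gf n]; at the norms of [a], [z] and [q] these stay bounded. *)
Lemma overpartition_sum_cvg (a z : K) :
  summability.partial_sum (fun l : strict_overpartition =>
    overpartition_weight K a z q (sop_seq l)) @ summability.totally -->
  limn (overpartition_gf K a z q).
Proof.
have q01 : 0 <= `|q| < 1 by rewrite normr_ge0.
have [B gB] :=
  gf_bounded _ prod_bounded _ _ _ (normr_ge0 a) (normr_ge0 z) q01.
apply: (partial_sum_cvg _ summable_cvg _ _ overpartition_fset _ B).
- move=> m n mn; apply/fsubsetP => l; rewrite !in_overpartition_fset => lm.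
  exact: leq_trans mn.
- by move=> l; exists (part l 0).+1; rewrite in_overpartition_fset.
- move=> n; rewrite (eq_bigr (fun l : strict_overpartition =>
    overpartition_weight K `|a| `|z| `|q| (sop_seq l))).
    by rewrite sum_overpartition_fset.
  by move=> l _; exact: norm_overpartition_weight.
- have -> : (fun n => \sum_(l <- overpartition_fset n)
      overpartition_weight K a z q (sop_seq l)) = overpartition_gf K a z q.
    by apply/funext => n; exact: sum_overpartition_fset.
  exact: (gf_cvg _ summable_cvg prod_bounded _ q1).
Qed.

End Identities.

(** * The identities over the complex field *)

Theorem theorem4p5 (R : realType) (a z q : complexField R) (hq : `|q| < 1) :
  let w := fun l : strict_overpartition =>
    a ^+ num_overlined l * z ^+ num_parts l * q ^+ sum_parts l in
  let u := fun n : nat =>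
    qpoch (- a * q) q n / qpoch q q n * z ^+ n * q ^+ (n * (n + 1) %/ 2)%N in
  let v := fun n : nat =>
    (- a * q) ^+ n / (qpoch q q n * qpoch (- z * q) q n) in
  [/\ cvg (summability.partial_sum w @ summability.totally),
      cvgn (series u),
      summability.sum w = limn (series u),
      cvgn (qpoch (- a * q) q) /\ cvgn (qpoch (- z * q) q) &
      `|a * q| < 1 -> (forall k : nat, 1 + z * q ^+ k.+1 != 0) ->
      cvgn (series v) /\
      limn (series u) =
        qpoch_inf (- a * q) q * qpoch_inf (- z * q) q * limn (series v)].
Proof.
move=> w u v.
have summable_cvg := bounded_series_cvg R.
have prod_bounded := prod_geometric_bounded R.
have w_cvg := overpartition_sum_cvg _ summable_cvg prod_bounded q hq a z.
have totallyF := @summability.totally_filter strict_overpartition.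
have uE := first_series_eq _ summable_cvg prod_bounded q hq a z.
split.
- exact: cvgP w_cvg.
- have [B uB] := first_series_summable _ prod_bounded q hq a z.
  exact: summable_cvg uB.
- by rewrite [RHS]uE; exact: cvg_lim w_cvg.
- by split; exact: (qpoch_cvg _ summable_cvg prod_bounded q hq).
- move=> aq1 z_neq0; rewrite [limn (series u)]uE.
  exact: (second_series_eq _ summable_cvg prod_bounded q hq a z aq1 z_neq0).
Qed.
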